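(* Let $t\geq 2$ be an integer, let $k$ be an even positive integer, and let $G=D(1,2,\dots,t)$. Then $\mathrm{rl}_k(G)\leq \frac t2 k^2+k$.
   Context: For a finite set $D=\{d_1<\dots<d_m\}$ of positive integers, the distance graph $D(d_1,\dots,d_m)$ has vertex set $\mathbb{Z}$, two distinct integers $i,j$ being adjacent iff $|i-j|\in D$. For a connected graph $G$ with graph distance $d(\cdot,\cdot)$ and an integer $k\ge 1$, a radio $k$-labeling of $G$ is a map $c:V(G)\to\mathbb{Z}_{\ge 0}$ such that $|c(u)-c(v)|\geq k+1-d(u,v)$ for all distinct vertices $u,v$. Its span is $\max\{c(x)-c(y): x,y\in V(G)\}$ (a supremum for infinite graphs), and the radio $k$-labeling number $\mathrm{rl}_k(G)$ is the minimum span over all radio $k$-labelings of $G$. *)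

(* Defs.v *)
From mathcomp Require Import all_boot all_order all_algebra.
From mathcomp Require Import all_classical all_reals ereal.
Set Implicit Arguments.
Unset Strict Implicit.
Unset Printing Implicit Defensive.
Import Order.TTheory GRing.Theory Num.Theory.
Local Open Scope classical_set_scope.
Local Open Scope ring_scope.

Definition has_walk (V : Type) (e : rel V) (u v : V) (n : nat) : bool :=
  `[< exists p : seq V, [/\ path e u p, last u p = v & size p = n] >].

Definition connected_graph (V : Type) (e : rel V) : Prop :=
  forall u v, exists n, has_walk e u v n.

(* The length of a shortest walk from u to v; the value 0 when there is none is
   irrelevant for connected graphs. *)
Definition gdist (V : Type) (e : rel V) (u v : V) : nat :=
  if pselect (exists n, has_walk e u v n) is left h then ex_minn h else 0%N.

Definition radio_labeling (V : Type) (e : rel V) (k : nat) (c : V -> nat) : Prop :=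
  forall u v : V, u <> v ->
    k%:Z + 1 - (gdist e u v)%:Z <= `|(c u)%:Z - (c v)%:Z|.

Definition span (R : realType) (V : Type) (c : V -> nat) : \bar R :=
  ereal_sup [set ((c xy.1)%:R - (c xy.2)%:R)%:E | xy in [set: V * V]].

(* Spans lie in {0, 1, 2, ...; +oo}, so that this infimum is a minimum as soon as
   a radio labeling exists: see rl_attained below. *)
Definition rl (R : realType) (V : Type) (e : rel V) (k : nat) : \bar R :=
  ereal_inf [set span R c | c in radio_labeling e k].

Definition distance_graph (D : seq nat) : rel int :=
  fun i j => (i != j) && (absz (i - j) \in D).

Lemma distance_graph_connected (t : nat) :
  (0 < t)%N -> connected_graph (distance_graph (iota 1 t)).
Proof.
move=> t0.
have up n : forall i : int, has_walk (distance_graph (iota 1 t)) i (i + n%:Z) n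
                         /\ has_walk (distance_graph (iota 1 t)) i (i - n%:Z) n.
  elim: n => [|n IH] i.
    by split; apply/asboolP; exists [::]; split; rewrite ?subr0 ?addr0.
  have adj (s : int) : `|s|%N = 1%N -> distance_graph (iota 1 t) i (i + s).
    move=> s1; rewrite /distance_graph opprD addNKr abszN s1.
    rewrite mem_iota add1n /= ltnS t0 andbT.
    by apply/eqP => /esym/(canRL (addKr _)); rewrite addNr => s0; rewrite s0 in s1.
  split; apply/asboolP.
    have [/asboolP[p [pp lp sp]] _] := IH (i + 1).
    exists (i + 1 :: p); split=> /=; first by rewrite adj.
      by rewrite lp -addrA -intS.
    by rewrite sp.
  have [_ /asboolP[p [pp lp sp]]] := IH (i - 1).
  exists (i - 1 :: p); split=> /=; first by rewrite adj.
    by rewrite lp -addrA -opprD -intS.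
  by rewrite sp.
move=> u v; exists `|(v - u)|%N; have [h1 h2] := up `|v - u|%N u.
have [vu|/ltW vu] := leP 0 (v - u).
  by move: h1; rewrite gez0_abs // subrKC.
by move: h2; rewrite lez0_abs // opprK subrKC.
Qed.

Lemma span_val (R : realType) (V : Type) (c : V -> nat) : V ->
  span R c = +oo%E \/ exists n : nat, span R c = n%:R%:E.
Proof.
move=> v0.
have ub x y : (((c x)%:R - (c y)%:R)%:E <= span R c)%E.
  by apply: ereal_sup_ubound; exists (x, y).
have [[m hm]|nb] := pselect (exists m, forall x y, (c x - c y <= m)%N).
  right.
  pose P := fun n => `[< exists x y, (c x - c y)%N = n >].
  have Pex : exists n, P n by exists 0%N; apply/asboolP; exists v0, v0; rewrite subnn.
  have Pb n : P n -> (n <= m)%N by move=> /asboolP[x [y <-]].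
  case: (ex_maxnP Pex Pb) => n /asboolP[x [y xyn]] nmax.
  exists n; apply/eqP; rewrite eq_le; apply/andP; split.
    apply: ge_ereal_sup => _ [[a b] _ <-] /=; rewrite lee_fin lerBlDr -natrD ler_nat.
    by rewrite addnC -leq_subLR; apply: nmax; apply/asboolP; exists a, b.
  have [yx|/ltnW xy] := leqP (c y) (c x).
    by apply: le_trans (ub x y); rewrite lee_fin -natrB // xyn.
  apply: le_trans (ub x x); rewrite subrr -xyn.
  by move: xy; rewrite -subn_eq0 => /eqP ->.
left; apply/eqyP => r r0.
apply: contrapT => /negP; rewrite -ltNge => sr; apply: nb.
exists (Num.truncn r).+1 => x y.
have := lt_trans (le_lt_trans (ub x y) sr) _.
move=> /(_ (((Num.truncn r).+1)%:R%:E)); rewrite !lte_fin => h.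
by rewrite leq_subLR addnC -(ler_nat R) natrD -lerBlDr; apply/ltW/h/truncnS_gt.
Qed.

Lemma rl_attained (R : realType) (V : Type) (e : rel V) (k : nat) : V ->
  (exists c, radio_labeling e k c) ->
  exists2 c, radio_labeling e k c & span R c = rl R e k.
Proof.
move=> v0 [c0 hc0].
have lb c : radio_labeling e k c -> (rl R e k <= span R c)%E.
  by move=> hc; apply: ereal_inf_lbound; exists c.
pose P := fun n : nat => `[< exists2 c, radio_labeling e k c & span R c = n%:R%:E >].
have [Pex|nP] := pselect (exists n, P n).
  case: (ex_minnP Pex) => n /asboolP[c hc cn] nmin.
  exists c => //; apply/eqP; rewrite eq_le lb // andbT.
  apply: le_ereal_inf_tmp => _ [c' hc' <-].
  have [->|[n' E']] := span_val R c' v0; first by rewrite leey.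
  by rewrite cn E' lee_fin ler_nat; apply: nmin; apply/asboolP; exists c'.
have all_oo c : radio_labeling e k c -> span R c = +oo%E.
  move=> hc; have [//|[n E]] := span_val R c v0.
  by case: nP; exists n; apply/asboolP; exists c.
exists c0 => //; rewrite all_oo //; apply/esym/eqP.
rewrite -leye_eq; apply: le_ereal_inf_tmp => _ [c hc <-].
by rewrite all_oo.
Qed.

(* Main.v *)
Require Import Defs.
From mathcomp Require Import all_boot all_order all_algebra.
From mathcomp Require Import all_classical all_reals ereal.
From mathcomp Require Import zify ring.
Import Order.TTheory GRing.Theory Num.Theory.
Local Open Scope ring_scope.

(** Write k = 2h and p = 2ht + 3, and label u by h * (2u mod p), so that the
    span is at most h(p - 1) = t k^2 / 2 + k.  Two labels differ by h * j for
    some j >= 0.  If j >= 3 the gap is at least 3h >= k + 1; if j = 2 it is k and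
    any two distinct vertices are at distance at least 1.  If j = 1 then
    2(u - v) is +1 or -1 modulo the odd number p, which forces |u - v| >= ht + 1
    and hence a distance of at least h + 1.  If j = 0 then p divides u - v, and
    the distance is at least k + 1. *)

Lemma has_walk_gdist (V : Type) (e : rel V) (u v : V) :
  connected_graph e -> has_walk e u v (gdist e u v).
Proof.
move=> conn; rewrite /gdist; case: pselect => [h|/(_ (conn u v))//].
by case: ex_minnP.
Qed.

Lemma walk_iota_le (t : nat) (p : seq int) (u : int) :
  path (distance_graph (iota 1 t)) u p -> (`|u - last u p| <= t * size p)%N.
Proof.
elim: p u => [|x p IH] u /=; first by rewrite subrr.
case/andP=> /andP[_]; rewrite mem_iota => ux /IH; lia.
Qed.

(** Each edge moves an integer by at most [t]. This is the only source of lower bounds on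
    distances. *)
Lemma le_gdist_iota (t : nat) (u v : int) : (0 < t)%N ->
  (`|u - v| <= t * gdist (distance_graph (iota 1 t)) u v)%N.
Proof.
move=> t0.
have /asboolP[p [pp <- <-]] :=
  has_walk_gdist _ _ u v (distance_graph_connected t0).
exact: walk_iota_le.
Qed.

Definition double_mod_label (h t : nat) (u : int) : nat :=
  (h * `|((2 * u) %% (2 * (h * t) + 3)%N)%Z|)%N.

Lemma double_mod_label_le (h t : nat) (u : int) :
  (double_mod_label h t u <= h * (2 * (h * t) + 2))%N.
Proof.
rewrite /double_mod_label leq_mul2l; apply/orP; right.
set p := (2 * (h * t) + 3)%N.
have := @ltz_pmod (2 * u) p; have := @modz_ge0 (2 * u) p; lia.
Qed.

Lemma double_mod_label_radio (h t : nat) : (0 < h)%N -> (0 < t)%N ->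
  radio_labeling (distance_graph (iota 1 t)) (2 * h) (double_mod_label h t).
Proof.
move=> h0 t0 u v uv; have := le_gdist_iota _ u v t0.
rewrite /double_mod_label; set d := gdist _ _ _.
set p := (2 * (h * t) + 3)%N => dle.
have far (x : nat) : (x * t < `|u - v|)%N -> (x < d)%N.
  by move=> /leq_trans/(_ dle); rewrite mulnC ltn_pmul2l.
have p0 : p%:Z != 0 by lia.
have := divz_eq (2 * u) p; have := divz_eq (2 * v) p.
have := modz_ge0 (2 * u) p0; have := modz_ge0 (2 * v) p0.
set b := (_ %% _)%Z; set a := (_ %% _)%Z; set q := (_ %/ _)%Z.
set r := (_ %/ _)%Z => b0 a0 Ev Eu.
rewrite !PoszM !gez0_abs // -mulrBr normrM.
have : 2 * (u - v) = (r - q) * p%:Z + (a - b).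
  by rewrite mulrBr Eu Ev; ring.
(* From here on only [2 * (u - v) = s * p + j] matters, where the labels differ by [h * j] in
   absolute value. *)
move: (a - b) (r - q) => j s E {a b q r b0 a0 Eu Ev dle}.
have sp (m : int) : m <= `|s| -> m * p%:Z <= `|s * p%:Z|.
  by move=> ms; rewrite normrM ler_wpM2r.
have hj (m : int) : m <= `|j| -> h%:Z * m <= `|h%:Z| * `|j|.
  by move=> mj; rewrite ler_wpM2l.
have [j3|j3] := leP 3 `|j|; first by have := hj _ j3; lia.
have [j2|j2] := leP 2 `|j|.
  have : (0 < d)%N by apply: far; rewrite mul0n; lia.
  by have := hj _ j2; lia.
have [j1|j1] := leP 1 `|j|.
  (* With [s = 0] the odd number [j] would equal [2 * (u - v)]. Hence
     [2 * |u - v| >= p - 1 = 2 * (h * t) + 2]. *)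
  have s1 : 1 <= `|s|.
    have s0 : s <> 0 by move=> s0; move: E; rewrite s0 mul0r; lia.
    lia.
  have : (h < d)%N by apply: far; have := sp _ s1; rewrite /p in E *; lia.
  by have := hj _ j1; lia.
have j0 : j = 0 by lia.
have s2 : 2 <= `|s|.
  have s0 : s <> 0 by move=> s0; move: E; rewrite s0 mul0r; lia.
  (* Parity: [p = 2 * (h * t + 1) + 1] and [s * p = 2 * (u - v)], so [s] is even. Being nonzero, it
     gives [|u - v| >= p]. *)
  have : s = 2 * (u - v - s * (h * t + 1)%N%:Z).
    by rewrite /p in E; lia.
  lia.
have : (2 * h < d)%N by apply: far; have := sp _ s2; rewrite /p in E *; lia.
lia.
Qed.

Lemma span_le (R : realType) (V : Type) (c : V -> nat) (n : nat) :
  (forall x, (c x <= n)%N) -> (Defs.span R c <= n%:R%:E)%E.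
Proof.
move=> cn; apply: ge_ereal_sup => _ [[x y] _ <-] /=.
(* Labels are nonnegative, so subtracting [c y] cannot exceed the bound on [c x]. *)
rewrite lee_fin lerBlDr -natrD ler_nat; exact: leq_trans (leq_addr _ _).
Qed.

Theorem theorem2 (R : realType) (t k : nat) (ht : (2 <= t)%N) (hk : (0 < k)%N)
    (hk_even : ~~ odd k) :
  (rl R (distance_graph (iota 1 t)) k
     <= (t%:R / 2 * k%:R ^+ 2 + k%:R)%:E)%E.
Proof.
have [h kE] : exists h, k = (2 * h)%N by exists k./2; lia.
rewrite kE in hk *.
have -> : t%:R / 2 * (2 * h)%:R ^+ 2 + (2 * h)%:R
          = (h * (2 * (h * t) + 2))%:R :> R.
  by rewrite !(natrM, natrD); field.
apply: le_trans (span_le R _ _ _ (double_mod_label_le h t)).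
apply: ereal_inf_lbound; exists (double_mod_label h t) => //.
apply: double_mod_label_radio; lia.
Qed.
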